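(* Let $m\ge 3$ be an integer and let $f=g:\mathbb{F}_{2^m}\to\mathbb{F}_2$ be the same bent function. For $\epsilon\in\{0,1\}$ let $$D_\epsilon=\{(x,y)\in\mathbb{F}_{2^m}^2\setminus\{(0,0)\}: f(x)+g(y)=0 \text{ and } \mathrm{Tr}_1^m(x+y)=\epsilon\}$$ and $\mathcal{C}_{D_\epsilon}=\{(\mathrm{Tr}_1^m(ax+by))_{(x,y)\in D_\epsilon}: a,b\in\mathbb{F}_{2^m}\}$. Then: (1) $\mathcal{C}_{D_0}$ is a $[2^{2m-2}+2^{m-1}-1,\,2m-1,\,2^{2m-3}]$ code with weight enumerator $$1+(2^{2m-3}+2^{m-2}-1)x^{2^{2m-3}}+2^{2m-2}x^{2^{2m-3}+2^{m-2}}+(2^{2m-3}-2^{m-2})x^{2^{2m-3}+2^{m-1}}.$$ (2) $\mathcal{C}_{D_1}$ is a $[2^{2m-2},\,2m,\,2^{2m-3}-2^{m-2}]$ code with weight enumerator $$1+(2^{2m-1}-2)x^{2^{2m-3}}+2^{2m-2}x^{2^{2m-3}-2^{m-2}}+2^{2m-2}x^{2^{2m-3}+2^{m-2}}+x^{2^{2m-2}}.$$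
   Context: $\mathrm{Tr}_1^m$ is the absolute trace $\mathbb{F}_{2^m}\to\mathbb{F}_2$. A Boolean function $f:\mathbb{F}_{2^m}\to\mathbb{F}_2$ is bent if its Walsh transform $\hat f(\omega)=\sum_{x\in\mathbb{F}_{2^m}}(-1)^{f(x)+\mathrm{Tr}_1^m(\omega x)}$ takes only the values $\pm2^{m/2}$ (so $m$ is even). An $[n,k,d]$ code is a $k$-dimensional linear subspace of $\mathbb{F}_2^n$ with minimum Hamming distance $d$. Its weight enumerator is $1+A_1x+\cdots+A_nx^n$, where $A_i$ is the number of codewords of Hamming weight $i$. *)

(* Defs.v *)
From HB Require Import structures.
From mathcomp Require Import all_boot all_order all_algebra all_field.

Set Implicit Arguments.
Unset Strict Implicit.
Unset Printing Implicit Defensive.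

Import GRing.Theory Num.Theory.
Local Open Scope ring_scope.

(* When #|F| = 2 ^ m, the sum of the conjugates x ^+ (2 ^ i) lies in the prime
   subfield {0, 1} of F, which is identified with 'F_2 (see abs_traceE). *)
Definition abs_trace (F : finFieldType) (m : nat) (x : F) : 'F_2 :=
  ((\sum_(i < m) x ^+ (2 ^ i)) != 0)%:R.

Lemma abs_traceE (F : finFieldType) (m : nat) (x : F) :
  #|F| = (2 ^ m)%N ->
  (abs_trace m x : nat)%:R = \sum_(i < m) x ^+ (2 ^ i) :> F.
Proof.
move=> cF; set s := \sum_(i < m) _.
have ch2 : 2 \in [pchar F] by exact: card_finPcharP cF _.
have s2 : s ^+ 2 = s.
  rewrite -(pFrobenius_autE ch2) rmorph_sum /=.
  have -> : \sum_(i < m) pFrobenius_aut ch2 (x ^+ (2 ^ i)) =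
            \sum_(i < m) x ^+ (2 ^ i.+1).
    by apply: eq_bigr => i _; rewrite pFrobenius_autE -exprM -expnSr.
  apply: (@addrI _ x); rewrite -{1}[x]expr1 -[1%N]/(2 ^ 0)%N.
  rewrite -(big_ord_recl m (fun i => x ^+ (2 ^ i))) big_ord_recr /= -cF.
  by rewrite expf_card addrC.
rewrite /abs_trace -/s; have [-> //|s0] := eqVneq s 0.
by apply: (mulfI s0); rewrite -expr2 s2 mulr1.
Qed.

(* The exponent is the representative 0 or 1 of an element of 'F_2. *)
Definition walsh (F : finFieldType) (m : nat) (f : F -> 'F_2) (w : F) : int :=
  \sum_(x : F) (-1) ^+ (f x + abs_trace m (w * x))%R.

(* 2^{m/2} is written as the m-th power of the square root of 2, so that it
   is meaningful for every m; the parity of m is then a consequence. *)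
Definition bent (F : finFieldType) (m : nat) (f : F -> 'F_2) : Prop :=
  forall w : F,
    (walsh m f w)%:~R = sqrtC 2 ^+ m :> algC \/
    (walsh m f w)%:~R = - (sqrtC 2 ^+ m) :> algC.

Definition defset (F : finFieldType) (m : nat) (f g : F -> 'F_2) (e : 'F_2) :
    {set F * F} :=
  [set p | [&& p != (0, 0), f p.1 + g p.2 == 0 & abs_trace m (p.1 + p.2) == e]].

Definition codeword (F : finFieldType) (m : nat) (D : {set F * F}) (a b : F) :
    'rV['F_2]_#|D| :=
  \row_i abs_trace m (a * (enum_val i).1 + b * (enum_val i).2).

Definition trace_code (F : finFieldType) (m : nat) (D : {set F * F}) :
    {set 'rV['F_2]_#|D|} :=
  [set codeword m D a b | a : F, b : F].

Definition hamming_dist (n : nat) (u v : 'rV['F_2]_n) : nat :=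
  #|[set i | u 0 i != v 0 i]|.

Definition hamming_weight (n : nat) (u : 'rV['F_2]_n) : nat :=
  #|[set i | u 0 i != 0]|.

Definition min_distance (n : nat) (C : {set 'rV['F_2]_n}) (d : nat) : Prop :=
  (exists u v, [/\ u \in C, v \in C, u != v & hamming_dist u v = d]) /\
  (forall u v, u \in C -> v \in C -> u != v -> (d <= hamming_dist u v)%N).

(* The length N of C is part of its type and only propositionally equal to n. *)
Definition is_code (n k d : nat) (N : nat) (C : {set 'rV['F_2]_N}) : Prop :=
  [/\ N = n,
      exists V : {vspace 'rV['F_2]_N}, C =i V /\ \dim V = k
    & min_distance C d].

Definition weight_enumerator (n : nat) (C : {set 'rV['F_2]_n}) : {poly int} :=
  1 + \sum_(1 <= i < n.+1) (#|[set u in C | hamming_weight u == i]|)%:R *: 'X^i.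

(* Main.v *)
(* Write W for the Walsh transform of f, chi x = (-1)^Tr(x) and q = 2^m. The
   indicator function of the defining set, with the origin added when e = 0, is
   (1 + (-1)^(f x + f y)) (1 + (-1)^e chi(x + y)) / 4, so orthogonality of
   characters gives, for the weight w of the codeword of (a, b),
     8 w = q^2 + q + (-1)^e q - (q^2 [(a,b) = (0,0)] + W(a) W(b))
           - (-1)^e (q^2 [(a,b) = (1,1)] + W(a+1) W(b+1)).
   Since f is bent, W(a) W(b) and W(a+1) W(b+1) are both q or -q. How often each
   of the four sign patterns occurs follows from the values q^2, q^2 and 0 of the
   sums over (a, b) of W(a) W(b), of W(a+1) W(b+1) and of their product. For
   e = 0 the pair (1,1) gives the zero codeword, whence the dimension 2m - 1. *)
Require Import Defs.
From HB Require Import structures.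
From mathcomp Require Import all_boot all_order all_algebra all_field.
From mathcomp Require Import ring zify.

Set Implicit Arguments.
Unset Strict Implicit.
Unset Printing Implicit Defensive.

Import GRing.Theory Num.Theory.
Local Open Scope ring_scope.

(** * Signs attached to elements of ['F_2] *)

Lemma F2_cases (x : 'F_2) : x = 0 \/ x = 1.
Proof. by case: x => [[|[|k]] Hk] //; [left | right]; apply/val_inj. Qed.

Definition sgnF2 (x : 'F_2) : int := (-1) ^+ x.

Lemma sgnF2_0 : sgnF2 0 = 1. Proof. by []. Qed.
Lemma sgnF2_1 : sgnF2 1 = -1. Proof. by []. Qed.

Lemma sgnF2D x y : sgnF2 (x + y) = sgnF2 x * sgnF2 y.
Proof. by case: (F2_cases x) => ->; case: (F2_cases y) => ->. Qed.

Lemma sgnF2_sqr x : sgnF2 x * sgnF2 x = 1.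
Proof. by case: (F2_cases x) => ->. Qed.

Lemma sgnF2_eq (x y : 'F_2) : 2 * (x == y)%:R = 1 + sgnF2 x * sgnF2 y.
Proof. by case: (F2_cases x) => ->; case: (F2_cases y) => ->. Qed.

Lemma sgnF2_neq0 (x : 'F_2) : 2 * (x != 0)%R%:R = 1 - sgnF2 x :> int.
Proof. by case: (F2_cases x) => ->. Qed.

(** * Trace, additive characters and their orthogonality *)

Section Characters.

Variables (m : nat) (F : finFieldType).
Hypothesis cardF : #|F| = (2 ^ m)%N.

Local Notation Tr := (@abs_trace F m).

Lemma pchar2 : 2 \in [pchar F].
Proof. exact: card_finPcharP cardF _. Qed.

Lemma addrr2 (x : F) : x + x = 0.
Proof. exact: (addrr_pchar2 pchar2). Qed.

Lemma oppr2 (x : F) : - x = x.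
Proof. exact: (oppr_pchar2 pchar2). Qed.

Lemma F2_to_field_inj : injective (fun e : 'F_2 => (e : nat)%:R : F).
Proof.
move=> e e'; case: (F2_cases e) => ->; case: (F2_cases e') => -> //= /eqP.
  by rewrite eq_sym oner_eq0.
by rewrite oner_eq0.
Qed.

Lemma F2_to_fieldD (e e' : 'F_2) :
  (nat_of_ord (e + e')%R)%:R = (e : nat)%:R + (e' : nat)%:R :> F.
Proof.
by case: (F2_cases e) => ->; case: (F2_cases e') => ->;
  rewrite /= ?add0r ?addr0 ?addrr2.
Qed.

(** [abs_trace] is a nonvanishing test, so additivity is not visible in ['F_2]. It is checked after
    embedding ['F_2] into [F], where [abs_traceE] gives a sum of Frobenius iterates, each
    additive. *)
Lemma abs_traceD x y : Tr (x + y) = Tr x + Tr y.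
Proof.
apply: F2_to_field_inj; rewrite F2_to_fieldD !abs_traceE // -big_split /=.
apply: eq_bigr => i _; elim: (nat_of_ord i) => [|k IH]; first by rewrite !expr1.
by rewrite expnSr !exprM IH -!(pFrobenius_autE pchar2) rmorphD.
Qed.

Lemma abs_trace0 : Tr 0 = 0.
Proof. by apply: (addrI (Tr 0)); rewrite -abs_traceD !addr0. Qed.

Lemma abs_trace_neq0 : (0 < m)%N -> exists x, Tr x != 0.
Proof.
(* The trace is given by a polynomial of degree 2 ^ (m - 1) < #|F|. *)
move=> m_gt0; apply/existsP; apply/negbNE/negP => /existsPn tr0.
pose p : {poly F} := \sum_(i < m) 'X^(2 ^ i).
have p_neq0 : p != 0.
  (* The coefficient of X in [p] is 1: only [i = 0] has exponent 1, the others are even. *)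
  apply/eqP => /(congr1 (fun q : {poly F} => q`_1)); rewrite coef0 /p.
  rewrite -(prednK m_gt0) big_ord_recl coefD coefX coef_sum big1.
    by move=> /eqP; rewrite addr0 eqxx oner_eq0.
  move=> i _; rewrite coefXn /= /bump /= add1n expnS.
  by case: eqP => //; lia.
have size_p : (size p <= (2 ^ m.-1).+1)%N.
  apply: (leq_trans (size_sum _ _ _)); apply/bigmax_leqP => i _.
  by rewrite size_polyXn ltnS leq_exp2l //; have := ltn_ord i; lia.
have roots_p : all (root p) (enum F).
  apply/allP => x _; have := tr0 x; rewrite negbK => /eqP trx.
  rewrite /root /p horner_sum; apply/eqP.
  under eq_bigr do rewrite hornerXn.
  by rewrite -abs_traceE // trx.
have := max_poly_roots p_neq0 roots_p (enum_uniq F).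
rewrite -cardE cardF => /leq_trans/(_ size_p).
by rewrite ltnS leqNgt ltn_exp2l // prednK // leqnn.
Qed.

Definition chi (x : F) : int := sgnF2 (Tr x).

Lemma chiD x y : chi (x + y) = chi x * chi y.
Proof. by rewrite /chi abs_traceD sgnF2D. Qed.

Lemma chi0 : chi 0 = 1.
Proof. by rewrite /chi abs_trace0. Qed.

Hypothesis m_gt0 : (0 < m)%N.

(** For nonzero [a], translating the variable by [a^-1 * y] with [y] of trace 1 multiplies the sum
    by -1, so it vanishes. *)
Lemma sum_chi a : \sum_x chi (a * x) = (2 ^ m * (a == 0))%:R.
Proof.
have [->|a0] := eqVneq a 0.
  under eq_bigr do rewrite mul0r chi0.
  by rewrite sumr_const cardF muln1.
rewrite muln0; have [y try] := abs_trace_neq0 m_gt0.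
have chiy : chi (a * (a^-1 * y)) = -1.
  by rewrite mulVKf // /chi; case: (F2_cases (Tr y)) try => ->.
have : \sum_x chi (a * x) = - \sum_x chi (a * x).
  rewrite {1}(reindex_inj (addIr (a^-1 * y))) /= -mulrN1 mulr_suml.
  by apply: eq_bigr => x _; rewrite mulrDr chiD chiy.
by lia.
Qed.

Lemma sum_chi2 a b :
  \sum_p chi (a * p.1 + b * p.2) = (2 ^ m * 2 ^ m * ((a, b) == (0, 0)))%:R.
Proof.
under eq_bigr do rewrite chiD.
rewrite -(pair_bigA _ (fun x y => chi (a * x) * chi (b * y))) /= -big_distrlr /=.
by rewrite !sum_chi xpair_eqE -natrM -mulnb mulnACA.
Qed.

(** * Walsh transform: moments and the bent condition *)

Variable f : F -> 'F_2.

Local Notation W := (@walsh F m f).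

Lemma walshE w : W w = \sum_x sgnF2 (f x) * chi (w * x).
Proof. by apply: eq_bigr => x _; rewrite -sgnF2D. Qed.

Lemma sum_walsh2 a b :
  \sum_p sgnF2 (f p.1 + f p.2) * chi (a * p.1 + b * p.2) = W a * W b.
Proof.
rewrite !walshE big_distrlr pair_bigA /=.
by apply: eq_bigr => p _; rewrite sgnF2D chiD mulrACA.
Qed.

Lemma sum_walsh : \sum_w W w = (2 ^ m)%:R * sgnF2 (f 0).
Proof.
under eq_bigr do rewrite walshE.
rewrite exchange_big (bigD1 0) //= [X in _ + X]big1 ?addr0.
  rewrite -mulr_sumr; under eq_bigr do rewrite mulrC.
  by rewrite sum_chi eqxx muln1 mulrC.
move=> x x0; rewrite -mulr_sumr; under eq_bigr do rewrite mulrC.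
by rewrite sum_chi (negbTE x0) muln0 mulr0.
Qed.

(** Summing over [w] first leaves the diagonal x = y. There the signs of [f] cancel, and what
    remains is a multiple of the sum of the nontrivial character [chi]. *)
Lemma sum_walsh_shift : \sum_w W w * W (w + 1) = 0.
Proof.
under eq_bigr do rewrite -sum_walsh2.
rewrite exchange_big /=.
transitivity (\sum_(p : F * F) sgnF2 (f p.1 + f p.2) * chi p.2
                 * (2 ^ m * (p.1 + p.2 == 0))%:R).
  apply: eq_bigr => p _; rewrite -sum_chi mulr_sumr; apply: eq_bigr => w _.
  by rewrite -mulrA -chiD; congr (_ * chi _); ring.
rewrite -(pair_bigA _ (fun x y => sgnF2 (f x + f y) * chi y
                                  * (2 ^ m * (x + y == 0))%:R)) /=.
transitivity (\sum_x chi (1 * x) * (2 ^ m)%:R).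
  apply: eq_bigr => x _; rewrite (bigD1 x) //= big1.
    by rewrite addrr2 eqxx muln1 sgnF2D sgnF2_sqr mul1r mul1r addr0.
  move=> y yx; rewrite addr_eq0 oppr2 eq_sym (negbTE yx).
  by rewrite muln0 mulr0.
by rewrite -mulr_suml sum_chi oner_eq0 muln0 mul0r.
Qed.

Hypothesis bent_f : bent m f.

Lemma walsh_sqr w : W w * W w = (2 ^ m)%:R.
Proof.
(* Both alternatives of [bent] have the same square, so the identity is proved in [algC] and pulled
   back to [int]. *)
apply: (@intr_inj algC); rewrite rmorphM /= rmorph_nat -expr2.
have sqrt2 : (sqrtC 2 ^+ m) ^+ 2 = (2 ^ m)%:R :> algC.
  by rewrite exprAC sqrtCK natrX.
by case: (bent_f w) => ->; rewrite ?sqrrN sqrt2.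
Qed.

Lemma walsh_mul_cases a b : W a * W b = (2 ^ m)%:R \/ W a * W b = - (2 ^ m)%:R.
Proof.
have : (W a * W b) ^+ 2 == (2 ^ m)%:R ^+ 2.
  by rewrite expr2 mulrACA !walsh_sqr -expr2.
by rewrite eqf_sqr => /orP[] /eqP; [left | right].
Qed.

End Characters.

(* MathComp does not declare the product of two finZmodTypes as a finZmodType. *)
HB.saturate prod.

(** * Hamming weights and weight enumerators *)

Lemma hamming_weight_eq0 n (u : 'rV['F_2]_n) : (hamming_weight u == 0%N) = (u == 0).
Proof.
rewrite /hamming_weight cards_eq0; apply/eqP/eqP => [u0 | ->].
  apply/rowP => i; rewrite mxE; apply/eqP/negbNE.
  by have /setP/(_ i) := u0; rewrite !inE => ->.
by apply/setP => i; rewrite !inE mxE eqxx.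
Qed.

Lemma hamming_distE n (u v : 'rV['F_2]_n) : hamming_dist u v = hamming_weight (u - v).
Proof.
by apply: eq_card => i; rewrite !inE !mxE subr_eq0.
Qed.

Lemma hamming_weight_le n (u : 'rV['F_2]_n) : (hamming_weight u <= n)%N.
Proof. by rewrite -[X in (_ <= X)%N]card_ord max_card. Qed.

(** The leading 1 of the enumerator is the term of weight 0, which only the zero word has. The
    enumerator thus becomes a sum over codewords, ready to be pulled back to a parameter space. *)
Lemma weight_enumeratorE n (C : {set 'rV['F_2]_n}) : 0 \in C ->
  weight_enumerator C = \sum_(u in C) 'X^(hamming_weight u).
Proof.
move=> C0.
transitivity (\sum_(0 <= i < n.+1)
    #|[set u in C | hamming_weight u == i]|%:R *: 'X^i : {poly int}).
  rewrite /weight_enumerator [RHS]big_nat_recl // -(big_add1 _ _ 0 n.+1 xpredT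
    (fun i => #|[set u in C | hamming_weight u == i]|%:R *: 'X^i)).
  congr (_ + _); rewrite expr0.
  suff -> : [set u in C | hamming_weight u == 0%N] = [set 0].
    by rewrite cards1 scale1r.
  apply/setP => u; rewrite !inE hamming_weight_eq0.
  by case: eqP => [->|]; rewrite ?C0 ?andbF.
rewrite big_mkord (partition_big (fun u => inord (hamming_weight u) : 'I_n.+1) xpredT) //=.
apply: eq_bigr => i _; transitivity (\sum_(u in C | hamming_weight u == i) 'X^i : {poly int}).
  by rewrite sumr_const -scaler_nat; congr (_%:R *: _); apply: eq_card => u; rewrite !inE.
apply: eq_big => [u|u /andP[_ /eqP ->]] //.
by rewrite -val_eqE /= inordK // ltnS hamming_weight_le.
Qed.

(** * Codes given as images of additive maps *)

Section AdditiveCode.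

Variables (T : finZmodType) (n : nat) (phi : T -> 'rV['F_2]_n).
Hypothesis phiD : {morph phi : x y / x + y}.

Local Notation code := [set phi x | x in T].
Local Notation ker := [set x | phi x == 0].

Lemma additive_phi0 : phi 0 = 0.
Proof. by apply: (addrI (phi 0)); rewrite -phiD !addr0. Qed.

Lemma additive_phiB x y : phi (x - y) = phi x - phi y.
Proof. by apply: (addIr (phi y)); rewrite -phiD !subrK. Qed.

Lemma code0 : 0 \in code.
Proof. by apply/imsetP; exists 0; rewrite ?additive_phi0. Qed.

Lemma codeD u v : u \in code -> v \in code -> u + v \in code.
Proof.
by move=> /imsetP[x _ ->] /imsetP[y _ ->]; rewrite -phiD imset_f.
Qed.

(** Every fibre of [phi] is a translate of the kernel, so each codeword is hit [#|ker|] times.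
    Multiplying by that number avoids a division. *)
Lemma sum_code (V : nmodType) (G : 'rV['F_2]_n -> V) :
  (\sum_(u in code) G u) *+ #|ker| = \sum_x G (phi x).
Proof.
rewrite [RHS](partition_big_imset phi) /= -sumrMnl; apply: eq_bigr => u.
case/imsetP => x0 _ ->{u}.
rewrite -sumr_const (reindex_inj (addrI (- x0))) /=.
apply: eq_big => [x|x]; last by rewrite inE addrC additive_phiB subr_eq0 => /eqP->.
by rewrite inE addrC additive_phiB subr_eq0.
Qed.

(** The only scalars are 0 and 1, so an additively closed set containing 0 equals its span. The
    dimension follows from [sum_code] with constant summand 1. *)
Lemma code_vspace :
  exists V : {vspace 'rV['F_2]_n}, code =i V /\ (2 ^ \dim V * #|ker| = #|T|)%N.
Proof.
pose V := <<enum code>>%VS.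
have codeV : code =i V.
  move=> u; apply/idP/idP => [uC|]; first by apply: memv_span; rewrite mem_enum.
  move=> /(coord_span (X := in_tuple (enum code))) ->.
  elim/big_ind: _ => [||i _]; [exact: code0 | exact: codeD |].
  case: (F2_cases (coord (in_tuple (enum code)) i u)) => ->.
    by rewrite scale0r code0.
  by rewrite scale1r -mem_enum mem_nth.
exists V; split=> //.
have := card_vspace V; rewrite card_Fp // => <-.
rewrite -(eq_card codeV).
have := @sum_code nat (fun=> 1%N).
by rewrite !sum1_card -mulr_natr => <-; rewrite !ssralg.natrE.
Qed.

Lemma min_distance_code d : (0 < d)%N ->
  (exists x, hamming_weight (phi x) = d) ->
  (forall x, phi x != 0 -> (d <= hamming_weight (phi x))%N) ->
  min_distance code d.
Proof.
move=> d_gt0 [x wx] dmin; split.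
  (* Comparison with the zero word turns a weight into a distance; [d_gt0] makes the two words
     distinct. *)
  exists (phi x), 0; rewrite imset_f // code0 hamming_distE subr0; split=> //.
  by rewrite -hamming_weight_eq0 wx -lt0n.
move=> _ _ /imsetP[y _ ->] /imsetP[z _ ->] neq_yz.
by rewrite hamming_distE -additive_phiB dmin // additive_phiB subr_eq0.
Qed.

Lemma weight_enumerator_code :
  weight_enumerator code *+ #|ker| = \sum_x 'X^(hamming_weight (phi x)).
Proof.
by rewrite weight_enumeratorE ?code0 // (@sum_code _ (fun u => 'X^(hamming_weight u))).
Qed.

End AdditiveCode.

(** * Weights of trace codewords in terms of Walsh values *)

Lemma hamming_weight_codeword (m : nat) (F : finFieldType) (D : {set F * F}) a b :
  hamming_weight (codeword m D a b) =
  (\sum_(p in D) (abs_trace m (a * p.1 + b * p.2) != 0)%R)%N.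
Proof.
rewrite /hamming_weight -sum1dep_card [RHS]big_enum_val [LHS]big_mkcond.
by apply: eq_bigr => i _; rewrite mxE; case: (_ != 0).
Qed.

Section TraceCode.

Variables (m : nat) (F : finFieldType).
Hypothesis cardF : #|F| = (2 ^ m)%N.
Hypothesis m_gt0 : (0 < m)%N.

Definition pair_codeword (D : {set F * F}) (p : F * F) := codeword m D p.1 p.2.

Lemma trace_codeE D : trace_code m D = [set pair_codeword D p | p : F * F].
Proof.
apply/setP => u; apply/imset2P/imsetP => [[a b _ _ ->]|[[a b] _ ->]].
  by exists (a, b).
by exists a b.
Qed.

Lemma pair_codewordD D : {morph pair_codeword D : p q / p + q}.
Proof.
move=> [a b] [c d]; apply/rowP => i; rewrite !mxE -abs_traceD //=.
by congr abs_trace; ring.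
Qed.

Variable f : F -> 'F_2.
Hypothesis bent_f : bent m f.

Local Notation W := (@walsh F m f).
Local Notation chi := (@chi m F).
Local Notation q := ((2 ^ m)%:R : int).

(* Four times the indicator function of [defset m f f e] with (0, 0) added if [e = 0]. *)
Definition defset_ind4 (e : 'F_2) (p : F * F) : int :=
  (1 + sgnF2 (f p.1 + f p.2)) * (1 + sgnF2 e * chi (p.1 + p.2)).

Lemma defset_ind4E e p :
  defset_ind4 e p =
  4 * ((p \in defset m f f e) + ((p == (0, 0)) && (e == 0)))%:R.
Proof.
rewrite inE /defset_ind4.
have -> : 1 + sgnF2 e * chi (p.1 + p.2) = 2 * (abs_trace m (p.1 + p.2) == e)%:R.
  by rewrite sgnF2_eq mulrC.
have -> : 1 + sgnF2 (f p.1 + f p.2) = 2 * (f p.1 + f p.2 == 0)%R%:R.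
  by rewrite sgnF2_eq mulr1.
rewrite mulrACA -[(_ == 0)%R%:R * _]natrM mulnb; congr (_ * _%:R).
have [->|p0] := eqVneq p (0, 0); last by rewrite addn0.
(* At the origin f(0) + f(0) = 0 and the trace is 0, so both conditions hold exactly when
   [e = 0]. *)
rewrite !addr0 abs_trace0 // andFb add0n [e == 0]eq_sym.
by case: (F2_cases (f 0)) => ->.
Qed.

(** When the product is expanded, the factor [chi (p.1 + p.2)] shifts the frequency (a, b) by (1,
    1), which moves the delta term to (1, 1) in characteristic 2. *)
Lemma sum_defset_ind4 e a b :
  \sum_p defset_ind4 e p * chi (a * p.1 + b * p.2) =
    q * q * ((a, b) == (0, 0))%:R + W a * W b
    + sgnF2 e * (q * q * ((a, b) == (1, 1))%:R + W (a + 1) * W (b + 1)).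
Proof.
have -> : ((a, b) == (1, 1)) = ((a + 1, b + 1) == (0, 0)).
  by rewrite !xpair_eqE !addr_eq0 !(oppr2 cardF).
rewrite -!natrM -!(sum_chi2 cardF m_gt0) -!(sum_walsh2 cardF).
rewrite -!big_split mulr_sumr -big_split /=; apply: eq_bigr => p _.
have -> : (a + 1) * p.1 + (b + 1) * p.2 = (p.1 + p.2) + (a * p.1 + b * p.2).
  by ring.
by rewrite (chiD cardF (p.1 + p.2)) /defset_ind4; ring.
Qed.

Lemma sum_defset_ind4_total e : \sum_p defset_ind4 e p = q * q + q + sgnF2 e * q.
Proof.
have := sum_defset_ind4 e 0 0; rewrite add0r !(walsh_sqr bent_f) eqxx mulr1.
rewrite xpair_eqE [0 == 1]eq_sym oner_eq0 mulr0 add0r => <-.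
by apply: eq_bigr => p _; rewrite !mul0r addr0 (chi0 cardF) mulr1.
Qed.

Lemma card_defset e :
  4 * (#|defset m f f e| + (e == 0)%R)%:R = q * q + q + sgnF2 e * q.
Proof.
rewrite -sum_defset_ind4_total; under eq_bigr do rewrite defset_ind4E.
rewrite -mulr_sumr -natr_sum big_split /=; congr (_ * (_ + _)%:R).
  by rewrite -sum1_card big_mkcond /=; apply: eq_bigr => p _; case: (_ \in _).
rewrite (bigD1 (0, 0)) //= eqxx big1 ?addn0 // => p p0.
by rewrite (negbTE p0).
Qed.

(** A position counts (1 - chi) / 2, so the weight is the total of the indicator minus its character
    sum, with 8 = 4 * 2. The origin added for [e = 0] is harmless because 1 - chi vanishes there. *)
Lemma weight_pair_codeword e a b :
  8 * (hamming_weight (pair_codeword (defset m f f e) (a, b)))%:R =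
    q * q + q + sgnF2 e * q
    - (q * q * ((a, b) == (0, 0))%:R + W a * W b)
    - sgnF2 e * (q * q * ((a, b) == (1, 1))%:R + W (a + 1) * W (b + 1)).
Proof.
rewrite -addrA -opprD -sum_defset_ind4 -sum_defset_ind4_total.
rewrite -sumrB /= hamming_weight_codeword natr_sum big_mkcond mulr_sumr /=.
apply: eq_bigr => p _.
rewrite -[X in X - _]mulr1 -mulrBr -sgnF2_neq0 defset_ind4E.
have [->|p0] := eqVneq p (0, 0).
  by rewrite !mulr0 addr0 abs_trace0 // eqxx inE eqxx /= !mulr0.
by rewrite addn0; case: (_ \in _) => /=; ring.
Qed.

(** * Distribution of the sign patterns of the Walsh products *)

Lemma sum_walsh_pair : \sum_(p : F * F) W p.1 * W p.2 = q * q.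
Proof.
rewrite -(pair_bigA _ (fun x y => W x * W y)) /= -big_distrlr /=.
by rewrite (sum_walsh cardF) // mulrACA sgnF2_sqr mulr1.
Qed.

Lemma sum_walsh_pair_shift : \sum_(p : F * F) W (p.1 + 1) * W (p.2 + 1) = q * q.
Proof. by rewrite -sum_walsh_pair [RHS](reindex_inj (addIr (1, 1))). Qed.

Lemma sum_walsh_pair_mul :
  \sum_(p : F * F) (W p.1 * W p.2) * (W (p.1 + 1) * W (p.2 + 1)) = 0.
Proof.
under eq_bigr do rewrite mulrACA.
rewrite -(pair_bigA _ (fun x y => W x * W (x + 1) * (W y * W (y + 1)))) /=.
by rewrite -big_distrlr /= (sum_walsh_shift cardF) // mul0r.
Qed.

Definition walsh_signs (s1 s2 : int) (p : F * F) : bool :=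
  (W p.1 * W p.2 == s1 * q) && (W (p.1 + 1) * W (p.2 + 1) == s2 * q).

(** A value u equal to q or -q satisfies 2q [u = sq] = q + su for a sign s. Two such identities are
    multiplied, which makes the indicator polynomial in the Walsh products. *)
Lemma walsh_signsE s1 s2 p : s1 ^+ 2 = 1 -> s2 ^+ 2 = 1 ->
  4 * (q * q) * (walsh_signs s1 s2 p)%:R =
  (q + s1 * (W p.1 * W p.2)) * (q + s2 * (W (p.1 + 1) * W (p.2 + 1))).
Proof.
have q0 : q != 0 by rewrite pnatr_eq0 expn_eq0.
have ind s a b : s ^+ 2 = 1 ->
    2 * q * (W a * W b == s * q)%:R = q + s * (W a * W b).
  move: q q0 (walsh_mul_cases bent_f a b) => c c0 Wab.
  move=> /eqP; rewrite sqrf_eq1 => /orP[] /eqP ->; case: Wab => ->;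
    rewrite ?mul1r ?mulN1r ?eqxx ?eqNr 1?[c == - c]eq_sym ?eqNr ?(negbTE c0) /=;
    by ring.
by move=> s1E s2E; rewrite -!ind // /walsh_signs -mulnb natrM; ring.
Qed.

(** Summing [walsh_signsE] over all pairs leaves only the three moments above, the mixed one being
    0; a factor [q * q] then cancels. *)
Lemma card_walsh_signs s1 s2 : s1 ^+ 2 = 1 -> s2 ^+ 2 = 1 ->
  4 * #|[set p | walsh_signs s1 s2 p]|%:R = q * q + (s1 + s2) * q.
Proof.
move=> s1E s2E.
have q0 : q * q != 0 by rewrite mulf_neq0 // pnatr_eq0 expn_eq0.
apply: (mulfI q0).
transitivity (\sum_(p : F * F) 4 * (q * q) * (walsh_signs s1 s2 p)%:R).
  rewrite -mulr_sumr -natr_sum mulrCA mulrA; congr (_ * _%:R).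
  by rewrite -sum1dep_card big_mkcond /=; apply: eq_bigr => p _; case: ifP.
transitivity (\sum_(p : F * F) (q * q + s1 * q * (W p.1 * W p.2)
    + s2 * q * (W (p.1 + 1) * W (p.2 + 1))
    + s1 * s2 * ((W p.1 * W p.2) * (W (p.1 + 1) * W (p.2 + 1))))).
  by apply: eq_bigr => p _; rewrite walsh_signsE //; ring.
rewrite !big_split /= -!mulr_sumr sum_walsh_pair sum_walsh_pair_shift.
rewrite sum_walsh_pair_mul sumr_const card_prod cardF -[q *+ _]mulr_natr natrM.
by ring.
Qed.

End TraceCode.

(** Cancels the kernel size 2 in the enumerator for [e = 0]. *)
Lemma poly_int_double_inj : injective (fun A : {poly int} => A *+ 2).
Proof.
move=> A B AB; apply/polyP => i; apply: (@pmulrnI _ 2) => //.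
by rewrite -!coefMn AB.
Qed.

Lemma sum_indicator_scale (T : finType) (P : pred T) (A : {poly int}) :
  \sum_x (P x)%:R *: A = #|[set x | P x]|%:Z *: A.
Proof.
rewrite -scaler_suml -natr_sum natz -sum1dep_card [in RHS]big_mkcond /=.
by congr (Posz _ *: A); apply: eq_bigr => x _; case: (P x).
Qed.

Lemma one_pair_neq0 (F : finFieldType) : ((1, 1) == (0, 0) :> F * F) = false.
Proof. by rewrite xpair_eqE oner_eq0. Qed.

(** * Parameters and weight distributions of the two codes *)

Section BentCode.

(* With t = 2 ^ (m - 3) all parameters of the two codes are polynomials in t. *)
Variables (m : nat) (F : finFieldType) (t : nat).
Hypothesis cardF : #|F| = (2 ^ m)%N.
Hypothesis m_gt0 : (0 < m)%N.
Hypothesis q8 : (2 ^ m = 8 * t)%N.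
Variable f : F -> 'F_2.
Hypothesis bent_f : bent m f.

Local Notation W := (@walsh F m f).
Local Notation q := ((2 ^ m)%:R : int).
Local Notation wt e p := (hamming_weight (pair_codeword m (defset m f f e%R) p)).

Lemma t_gt0 : (0 < t)%N.
Proof. by have := expn_gt0 2 m; rewrite q8; lia. Qed.

(** On the diagonal both products are squares of Walsh values, so both signs are 1. This fixes the
    signs at the exceptional pairs (0, 0) and (1, 1). *)
Lemma walsh_signs_cases p : exists s1 s2 : int,
  [/\ s1 = 1 \/ s1 = -1, s2 = 1 \/ s2 = -1, p.1 = p.2 -> s1 = 1 /\ s2 = 1,
      W p.1 * W p.2 = s1 * q /\ W (p.1 + 1) * W (p.2 + 1) = s2 * q
    & forall r1 r2, walsh_signs m f r1 r2 p = (r1 == s1) && (r2 == s2)].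
Proof.
have q0 : q != 0 by rewrite pnatr_eq0 expn_eq0.
have sgn a b : exists s : int,
    [/\ s = 1 \/ s = -1, a = b -> s = 1 & W a * W b = s * q].
  have [-> | ab] := eqVneq a b.
    by exists 1; rewrite (walsh_sqr bent_f) mul1r; split; auto.
  by case: (walsh_mul_cases bent_f a b) => ->; [exists 1 | exists (-1)];
    rewrite ?mul1r ?mulN1r; split=> //; auto=> /eqP; rewrite (negbTE ab).
have [[s1 [s1E s1d P1]] [s2 [s2E s2d P2]]] := (sgn p.1 p.2, sgn (p.1 + 1) (p.2 + 1)).
exists s1, s2; split=> //.
  by move=> diag; rewrite s1d // s2d // diag.
move=> r1 r2; rewrite /walsh_signs P1 P2 !(inj_eq (mulIf q0)).
by rewrite [_ == r1]eq_sym [_ == r2]eq_sym.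
Qed.

Lemma weight_pair_codeword8 e p :
  exists s1 s2 : int,
  [/\ s1 = 1 \/ s1 = -1, s2 = 1 \/ s2 = -1, p.1 = p.2 -> s1 = 1 /\ s2 = 1,
      forall r1 r2, walsh_signs m f r1 r2 p = (r1 == s1) && (r2 == s2)
    & (wt e p)%:Z = (8 * t * t)%:Z * (1 - (p == (0, 0))%:Z
                      - sgnF2 e * (p == (1, 1))%:Z)
      + t%:Z * (1 + sgnF2 e - s1 - sgnF2 e * s2)].
Proof.
have [s1 [s2 [s1E s2E diag [P1 P2] ws]]] := walsh_signs_cases p.
exists s1, s2; split=> //.
have := weight_pair_codeword cardF m_gt0 bent_f e p.1 p.2.
rewrite -surjective_pairing P1 P2 q8 !natz !PoszM; set w := Posz _.
by case: (F2_cases e) => ->; rewrite ?sgnF2_0 ?sgnF2_1;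
  case: (p == (0, 0)); case: (p == (1, 1)); rewrite /= ; lia.
Qed.

(** Each sign pattern determines a weight except at (0, 0) and (1, 1). Both have pattern (1, 1) but
    weight 0, hence the corrections replacing the monomial by 1. *)
Lemma weight_monomial0 p :
  'X^(wt 0 p) = (walsh_signs m f 1 1 p)%:R *: 'X^(8 * t * t)
    + (walsh_signs m f 1 (-1) p)%:R *: 'X^(8 * t * t + 2 * t)
    + (walsh_signs m f (-1) 1 p)%:R *: 'X^(8 * t * t + 2 * t)
    + (walsh_signs m f (-1) (-1) p)%:R *: 'X^(8 * t * t + 4 * t)
    + (p == (0, 0))%:R *: (1 - 'X^(8 * t * t))
    + (p == (1, 1))%:R *: (1 - 'X^(8 * t * t)) :> {poly int}.
Proof.
have [s1 [s2 [s1E s2E diag ws]]] := weight_pair_codeword8 0 p.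
rewrite !{}ws sgnF2_0; move: (wt 0 p) => w.
have [p0|p0] := eqVneq p (0, 0).
  have [-> ->] : s1 = 1 /\ s2 = 1 by apply: diag; rewrite p0.
  rewrite p0 eq_sym one_pair_neq0 /= => wE.
  have -> : w = 0%N by lia.
  by rewrite !scale0r !scale1r expr0 !addr0 addrC subrK.
have [p1|p1] := eqVneq p (1, 1).
  have [-> ->] : s1 = 1 /\ s2 = 1 by apply: diag; rewrite p1.
  rewrite /= => wE.
  have -> : w = 0%N by lia.
  by rewrite !scale0r !scale1r expr0 !addr0 addrC subrK.
rewrite !scale0r !addr0; case: s1E s2E => -> [] -> /= wE;
  rewrite ?scale0r ?scale1r ?addr0 ?add0r; congr ('X^_); lia.
Qed.

(** Here the pair (1, 1) yields the all-one word, since the trace of x + y is 1 on the defining set;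
    its correction puts in the full length [16 * t * t]. *)
Lemma weight_monomial1 p :
  'X^(wt 1 p) = (walsh_signs m f 1 1 p)%:R *: 'X^(8 * t * t)
    + (walsh_signs m f 1 (-1) p)%:R *: 'X^(8 * t * t - 2 * t)
    + (walsh_signs m f (-1) 1 p)%:R *: 'X^(8 * t * t + 2 * t)
    + (walsh_signs m f (-1) (-1) p)%:R *: 'X^(8 * t * t)
    + (p == (0, 0))%:R *: (1 - 'X^(8 * t * t))
    + (p == (1, 1))%:R *: ('X^(16 * t * t) - 'X^(8 * t * t)) :> {poly int}.
Proof.
have [s1 [s2 [s1E s2E diag ws]]] := weight_pair_codeword8 1 p.
(* Positivity of [t] gives 2t <= 8t^2, so the natural subtraction in the exponent is not
   truncated. *)
rewrite !{}ws sgnF2_1; move: (wt 1 p) t_gt0 => w t_gt0.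
have [p0|p0] := eqVneq p (0, 0).
  have [-> ->] : s1 = 1 /\ s2 = 1 by apply: diag; rewrite p0.
  rewrite p0 eq_sym one_pair_neq0 /= => wE.
  have -> : w = 0%N by lia.
  by rewrite !scale0r !scale1r expr0 !addr0 addrC subrK.
have [p1|p1] := eqVneq p (1, 1).
  have [-> ->] : s1 = 1 /\ s2 = 1 by apply: diag; rewrite p1.
  rewrite /= => wE.
  have -> : w = (16 * t * t)%N by lia.
  by rewrite !scale0r !scale1r !addr0 addrC subrK.
rewrite !scale0r !addr0; case: s1E s2E => -> [] -> /= wE;
  rewrite ?scale0r ?scale1r ?addr0 ?add0r; congr ('X^_); nia.
Qed.

Lemma card_walsh_signs8 (s1 s2 : int) : s1 ^+ 2 = 1 -> s2 ^+ 2 = 1 ->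
  #|[set p | walsh_signs m f s1 s2 p]|%:Z =
    (16 * t * t)%:Z + (s1 + s2) * (2 * t)%:Z.
Proof.
move=> s1E s2E; have := card_walsh_signs cardF m_gt0 bent_f s1E s2E.
rewrite q8 !natz !PoszM; set c := Posz _; lia.
Qed.

Lemma sum_weight_monomial0 :
  \sum_p 'X^(wt 0 p) = 2 *: (1 - 'X^(8 * t * t))
    + ((16 * t * t)%:Z + (4 * t)%:Z) *: 'X^(8 * t * t)
    + (32 * t * t)%:Z *: 'X^(8 * t * t + 2 * t)
    + ((16 * t * t)%:Z - (4 * t)%:Z) *: 'X^(8 * t * t + 4 * t) :> {poly int}.
Proof.
under eq_bigr do rewrite weight_monomial0.
rewrite !big_split /= !sum_indicator_scale !card_walsh_signs8 // !cardsE !card1.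
by apply/polyP => i; rewrite !(coefD, coefN, coefZ) !PoszM; ring.
Qed.

Lemma sum_weight_monomial1 :
  \sum_p 'X^(wt 1 p) = (1 - 'X^(8 * t * t)) + ('X^(16 * t * t) - 'X^(8 * t * t))
    + (32 * t * t)%:Z *: 'X^(8 * t * t)
    + (16 * t * t)%:Z *: 'X^(8 * t * t - 2 * t)
    + (16 * t * t)%:Z *: 'X^(8 * t * t + 2 * t) :> {poly int}.
Proof.
under eq_bigr do rewrite weight_monomial1.
rewrite !big_split /= !sum_indicator_scale !card_walsh_signs8 // !cardsE !card1.
by apply/polyP => i; rewrite !(coefD, coefN, coefZ) !PoszM; ring.
Qed.

Lemma weight0_ge (p : F * F) : p != (0, 0) -> p != (1, 1) -> (8 * t * t <= wt 0 p)%N.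
Proof.
move=> /negbTE p0 /negbTE p1.
have [s1 [s2 [s1E s2E _ _]]] := weight_pair_codeword8 0 p.
rewrite sgnF2_0 p0 p1; move: (wt 0 p) => w.
by case: s1E s2E => -> [] ->; lia.
Qed.

Lemma weight1_ge (p : F * F) : p != (0, 0) -> (8 * t * t - 2 * t <= wt 1 p)%N.
Proof.
move=> /negbTE p0.
have [s1 [s2 [s1E s2E _ _]]] := weight_pair_codeword8 1 p.
rewrite sgnF2_1 p0; move: (wt 1 p) => w.
by case: s1E s2E => -> [] ->; case: (p == _); nia.
Qed.

Lemma weight_kernel e p :
  p = (0, 0) \/ e = 0 /\ p = (1, 1) -> wt e p = 0%N.
Proof.
have [s1 [s2 [s1E s2E diag _]]] := weight_pair_codeword8 e p.
move: (wt e p) => w wE pE; move: wE.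
have [-> ->] : s1 = 1 /\ s2 = 1 by apply: diag; case: pE => [->|[_ ->]].
case: pE => [->|[-> ->]]; rewrite ?sgnF2_0 eqxx ?[_ == (1, 1)]eq_sym one_pair_neq0 /=.
  by case: (F2_cases e) => ->; rewrite ?sgnF2_0 ?sgnF2_1; lia.
by lia.
Qed.

Lemma card_kernel0 :
  #|[set p | pair_codeword m (defset m f f 0) p == 0]| = 2%N.
Proof.
transitivity #|[set (1, 1); (0, 0) : F * F]|; last by rewrite cards2 one_pair_neq0.
apply: eq_card => p; rewrite !inE -hamming_weight_eq0.
have [p1|p1] := eqVneq p (1, 1); first by rewrite weight_kernel ?eqxx; auto.
have [p0|p0] := eqVneq p (0, 0); first by rewrite weight_kernel ?eqxx; auto.
have := weight0_ge p0 p1; have := t_gt0; move: (wt 0 p) => w.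
by case: w => //; nia.
Qed.

Lemma card_kernel1 :
  #|[set p | pair_codeword m (defset m f f 1) p == 0]| = 1%N.
Proof.
transitivity #|[set (0, 0) : F * F]|; last by rewrite cards1.
apply: eq_card => p; rewrite !inE -hamming_weight_eq0.
have [p0|p0] := eqVneq p (0, 0); first by rewrite weight_kernel ?eqxx; auto.
have := weight1_ge p0; have := t_gt0; move: (wt 1 p) => w.
by case: w => //; nia.
Qed.

Lemma weight0_attained : exists p, wt 0 p = (8 * t * t)%N.
Proof.
have t_gt0 := t_gt0.
have c11 : (#|[set p | walsh_signs m f 1 1 p]| = 16 * t * t + 4 * t)%N.
  by have := @card_walsh_signs8 1 1 erefl erefl; lia.
(* Pattern (1, 1) gives the minimum weight but also occurs at the two kernel pairs; having more than
   2 pairs, it occurs elsewhere too. *)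
have /subsetPn[p] : ~~ ([set p | walsh_signs m f 1 1 p] \subset [set (1, 1); (0, 0)]).
  apply/negP => /subset_leq_card; rewrite c11 cards2 one_pair_neq0 /=; nia.
rewrite !inE negb_or => ws11 /andP[/negbTE p1 /negbTE p0]; exists p.
have [s1 [s2 [_ _ _ ws]]] := weight_pair_codeword8 0 p.
move: ws11; rewrite ws => /andP[/eqP <- /eqP <-]; rewrite sgnF2_0 p0 p1.
by move: (wt 0 p) => w; lia.
Qed.

Lemma weight1_attained : exists p, wt 1 p = (8 * t * t - 2 * t)%N.
Proof.
have t_gt0 := t_gt0.
have c11 : (#|[set p | walsh_signs m f 1 (-1) p]| = 16 * t * t)%N.
  by have := @card_walsh_signs8 1 (-1) erefl erefl; lia.
have /card_gt0P[p] : (0 < #|[set p | walsh_signs m f 1 (-1) p]|)%N by rewrite c11; nia.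
rewrite inE => ws11; exists p.
have [s1 [s2 [_ _ diag ws]]] := weight_pair_codeword8 1 p.
move: ws11 diag; rewrite ws => /andP[/eqP <- /eqP <-] diag; rewrite sgnF2_1.
(* Pattern (1, -1) cannot occur on the diagonal, which excludes both exceptional pairs. *)
have p0 : (p == (0, 0)) = false.
  by apply/eqP => p0; have [] : 1 = 1 :> int /\ -1 = 1 :> int by apply: diag; rewrite p0.
have p1 : (p == (1, 1)) = false.
  by apply/eqP => p1; have [] : 1 = 1 :> int /\ -1 = 1 :> int by apply: diag; rewrite p1.
by rewrite p0 p1; move: (wt 1 p) => w; nia.
Qed.

(** The final -1 is the origin, which satisfies both conditions but is excluded from the defining
    set. *)
Lemma card_defset0 : #|defset m f f 0| = (16 * t * t + 4 * t - 1)%N.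
Proof.
have := card_defset cardF m_gt0 bent_f 0; rewrite q8 eqxx sgnF2_0 !natz.
by move: #|_| => n; lia.
Qed.

Lemma card_defset1 : #|defset m f f 1| = (16 * t * t)%N.
Proof.
have := card_defset cardF m_gt0 bent_f 1; rewrite q8 oner_eq0 sgnF2_1 !natz.
by move: #|_| => n; lia.
Qed.

Lemma is_code0 :
  is_code (16 * t * t + 4 * t - 1) (2 * m - 1) (8 * t * t) (trace_code m (defset m f f 0)).
Proof.
have phiD := pair_codewordD cardF (defset m f f 0).
split; [exact: card_defset0 | |]; rewrite trace_codeE.
  have [V [VE dimV]] := code_vspace phiD; exists V; split=> //.
  (* The dimension is read off from powers of 2; the extra factor 2 is the kernel size. *)
  apply/eqP; rewrite -(eqn_exp2l _ _ (ltnSn 1)) -(eqn_pmul2r (ltn0Sn 1)).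
  move: dimV; rewrite card_kernel0 card_prod cardF => ->.
  by rewrite -expnD -expnSr; apply/eqP; congr (_ ^ _)%N; lia.
apply: min_distance_code weight0_attained _ => //.
  by have := t_gt0; nia.
move=> p; rewrite -hamming_weight_eq0 => wp; apply: weight0_ge.
  by apply: contraNneq wp => p0; rewrite weight_kernel; auto.
by apply: contraNneq wp => p0; rewrite weight_kernel; auto.
Qed.

Lemma is_code1 :
  is_code (16 * t * t) (2 * m) (8 * t * t - 2 * t) (trace_code m (defset m f f 1)).
Proof.
have phiD := pair_codewordD cardF (defset m f f 1).
split; [exact: card_defset1 | |]; rewrite trace_codeE.
  have [V [VE dimV]] := code_vspace phiD; exists V; split=> //.
  apply/eqP; rewrite -(eqn_exp2l _ _ (ltnSn 1)).
  move: dimV; rewrite card_kernel1 card_prod cardF muln1 => ->.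
  by rewrite -expnD; apply/eqP; congr (_ ^ _)%N; lia.
apply: min_distance_code weight1_attained _ => //.
  by have := t_gt0; nia.
move=> p; rewrite -hamming_weight_eq0 => wp; apply: weight1_ge.
by apply: contraNneq wp => p0; rewrite weight_kernel; auto.
Qed.

Lemma weight_enumerator0 :
  weight_enumerator (trace_code m (defset m f f 0)) =
    1 + ((8 * t * t)%:Z + (2 * t)%:Z - 1) *: 'X^(8 * t * t)
      + (16 * t * t)%:Z *: 'X^(8 * t * t + 2 * t)
      + ((8 * t * t)%:Z - (2 * t)%:Z) *: 'X^(8 * t * t + 4 * t).
Proof.
(* Each codeword comes from two pairs, so the doubled enumerators are compared. *)
apply: poly_int_double_inj; rewrite trace_codeE /= -[X in _ *+ X = _]card_kernel0.
rewrite (weight_enumerator_code (pair_codewordD cardF _)) sum_weight_monomial0.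
by apply/polyP => i; rewrite !(coefMn, coefD, coefN, coefZ) !PoszM; ring.
Qed.

Lemma weight_enumerator1 :
  weight_enumerator (trace_code m (defset m f f 1)) =
    1 + ((32 * t * t)%:Z - 2) *: 'X^(8 * t * t)
      + (16 * t * t)%:Z *: 'X^(8 * t * t - 2 * t)
      + (16 * t * t)%:Z *: 'X^(8 * t * t + 2 * t)
      + 'X^(16 * t * t).
Proof.
rewrite trace_codeE.
have := weight_enumerator_code (pair_codewordD cardF (defset m f f 1)).
rewrite card_kernel1 sum_weight_monomial1 mulr1n => ->.
by apply/polyP => i; rewrite !(coefD, coefN, coefZ) !PoszM; ring.
Qed.

End BentCode.

(** * Return from [t] to powers of 2 *)

Theorem corollary4p7 (m : nat) (hm : (3 <= m)%N) (F : finFieldType)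
    (hF : #|F| = (2 ^ m)%N) (f g : F -> 'F_2) (hf : bent m f) (hfg : f = g) :
  let C0 := trace_code m (defset m f g 0) in
  let C1 := trace_code m (defset m f g 1) in
  (is_code (2 ^ (2 * m - 2) + 2 ^ (m - 1) - 1) (2 * m - 1) (2 ^ (2 * m - 3)) C0
   /\ weight_enumerator C0 =
      1 + (2 ^+ (2 * m - 3) + 2 ^+ (m - 2) - 1) *: 'X^(2 ^ (2 * m - 3))
        + 2 ^+ (2 * m - 2) *: 'X^(2 ^ (2 * m - 3) + 2 ^ (m - 2))
        + (2 ^+ (2 * m - 3) - 2 ^+ (m - 2))
            *: 'X^(2 ^ (2 * m - 3) + 2 ^ (m - 1)))
  /\
  (is_code (2 ^ (2 * m - 2)) (2 * m) (2 ^ (2 * m - 3) - 2 ^ (m - 2)) C1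
   /\ weight_enumerator C1 =
      1 + (2 ^+ (2 * m - 1) - 2) *: 'X^(2 ^ (2 * m - 3))
        + 2 ^+ (2 * m - 2) *: 'X^(2 ^ (2 * m - 3) - 2 ^ (m - 2))
        + 2 ^+ (2 * m - 2) *: 'X^(2 ^ (2 * m - 3) + 2 ^ (m - 2))
        + 'X^(2 ^ (2 * m - 2))).
Proof.
move=> C0 C1; rewrite {}/C0 {}/C1 -{g}hfg.
have m_gt0 : (0 < m)%N by lia.
pose t := (2 ^ (m - 3))%N.
have powt a b : (a = b + (m - 3))%N -> (2 ^ a = 2 ^ b * t)%N.
  by move=> ->; rewrite expnD.
have powtt a b : (a = b + (m - 3) + (m - 3))%N -> (2 ^ a = 2 ^ b * t * t)%N.
  by move=> ->; rewrite !expnD.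
have q8 : (2 ^ m = 8 * t)%N by apply: (powt _ 3); lia.
have p1 : (2 ^ (m - 1) = 4 * t)%N by apply: (powt _ 2); lia.
have p2 : (2 ^ (m - 2) = 2 * t)%N by apply: (powt _ 1); lia.
have pp1 : (2 ^ (2 * m - 1) = 32 * t * t)%N by apply: (powtt _ 5); lia.
have pp2 : (2 ^ (2 * m - 2) = 16 * t * t)%N by apply: (powtt _ 4); lia.
have pp3 : (2 ^ (2 * m - 3) = 8 * t * t)%N by apply: (powtt _ 3); lia.
(* Integer powers in the coefficients become casts of natural powers, so the same equations rewrite
   coefficients and exponents. *)
rewrite -!natrX p1 p2 pp1 pp2 pp3 !natz.
split; split.
- exact: is_code0.
- exact: weight_enumerator0.
- exact: is_code1.
- exact: weight_enumerator1.
Qed.
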